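(* Let $n,k$ be integers with $1\le k\le n$. There is a constant $C>0$ depending only on $n$ and $k$ such that the following holds. Let $\mathbb{F}_q$ be a finite field with $q$ elements, let $S$ be a $0$-dimensional subscheme of $\mathbb{A}^n/\mathbb{F}_q$, and let $c\in[0,k]$ be a real number. Suppose that, for each $k$-plane $W\subset\mathbb{A}^n$ defined over $\mathbb{F}_q$, there is a $k$-plane $V$ (over $\mathbb{F}_q$) parallel to $W$ with $|S\cap V|\ge q^c$. Then $$|S| > C q^{cn/k}.$$
   Context: A $0$-dimensional subscheme $S$ of $\mathbb{A}^n/\mathbb{F}_q$ is $S=\operatorname{Spec} \mathbb{F}_q[x_1,\dots,x_n]/I_S$ for an ideal $I_S$ such that the quotient is a finite-dimensional $\mathbb{F}_q$-vector space (it need not be reduced), and $|S|:=\dim_{\mathbb{F}_q}\mathbb{F}_q[x_1,\dots,x_n]/I_S$. A $k$-plane is a $k$-dimensional affine-linear subspace of $\mathbb{A}^n$, cut out by $n-k$ polynomials $\ell_1,\dots,\ell_{n-k}$ of degree one with linearly independent linear parts; two $k$-planes are parallel if they are translates of the same $k$-dimensional linear subspace. $S\cap V$ is the scheme-theoretic intersection $\operatorname{Spec}\mathbb{F}_q[x_1,\dots,x_n]/(I_S+(\ell_1,\dots,\ell_{n-k}))$, and $|S\cap V|$ is the $\mathbb{F}_q$-dimension of its coordinate ring. *)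

(* Defs.v *)
From HB Require Import structures.
From mathcomp Require Export all_boot all_order all_algebra.
From mathcomp Require Export reals exp.
From mathcomp Require Export mpoly.

Set Implicit Arguments.
Unset Strict Implicit.
Unset Printing Implicit Defensive.

Import Order.TTheory GRing.Theory Num.Theory.
Local Open Scope ring_scope.

(* Ideals are allowed to be improper: the empty scheme corresponds to the
   unit ideal, and S \cap V is often empty. This excludes the library's
   [idealr], which requires 1 \notin I. *)
Definition is_ideal (R : comNzRingType) (I : R -> Prop) : Prop :=
  [/\ I 0, forall u v, I u -> I v -> I (u + v) & forall a u, I u -> I (a * u)].

(* [has_quot_dim I d]: the quotient F[x_1..x_n] / I is a vector space of finite
   dimension d over F, i.e. it is isomorphic to F^d; the isomorphism is given
   by the surjective linear map with kernel I that induces it. *)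
Definition has_quot_dim (F : fieldType) (n : nat)
    (I : {mpoly F[n]} -> Prop) (d : nat) : Prop :=
  exists phi : {linear {mpoly F[n]} -> 'rV[F]_d},
    (forall v, exists p, phi p = v) /\ (forall p, phi p = 0 <-> I p).

(* The ideal I + (l_0, ..., l_(m-1)). *)
Definition ideal_adjoin (R : comNzRingType) (m : nat)
    (I : R -> Prop) (l : 'I_m -> R) : R -> Prop :=
  fun p => exists2 f, I f & exists g : 'I_m -> R, p = f + \sum_i g i * l i.

Definition linear_part (F : fieldType) (n : nat) (p : {mpoly F[n]}) : 'rV[F]_n :=
  \row_j p@_U_(j).

(* [msize] is the degree plus one. *)
Record kplane (F : fieldType) (n k : nat) := KPlane {
  kplane_eqs :> 'I_(n - k) -> {mpoly F[n]};
  kplane_deg : forall i, msize (kplane_eqs i) = 2%N;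
  kplane_free : row_free (\matrix_i linear_part (kplane_eqs i))
}.

Definition on_kplane (F : fieldType) (n k : nat) (V : kplane F n k)
    (x : 'rV[F]_n) : Prop :=
  forall i, (V i).@[x 0] = 0.

(* A k-plane over F is determined by its F-points, so that being a translate
   of a linear subspace can be read on F-points. *)
Definition is_translate (F : fieldType) (n k : nat) (V : kplane F n k)
    (L : {vspace 'rV[F]_n}) : Prop :=
  exists v, forall x, on_kplane V x <-> x - v \in L.

Definition parallel (F : fieldType) (n k : nat) (V W : kplane F n k) : Prop :=
  exists L : {vspace 'rV[F]_n},
    [/\ \dim L = k, is_translate V L & is_translate W L].

(* Main.v *)
From mathcomp Require Import perm zify ring.
Require Import Defs.

(* The coordinate ring of S is M = F^s with commuting operators X_1, ..., X_n.
   Passing to the associated graded module for the degree filtration turns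
   them into operators G_1, ..., G_n for which the constant terms of the
   equations of a k-plane no longer matter, and sections can only grow. So one
   has to bound dim M from below when M / (l_1, ..., l_(n-k)) M has dimension at
   least q^c for all independent linear forms l_i over F, knowing that
   M / (G_1, ..., G_n) M has dimension at most 1.

   The heart of the matter is a pencil A + tB of linear forms over F_q. Let g be
   the corank of A + tB over F_q(t), and let e be the dimension of
   M / (A, B) M. A nonzero maximal minor of A + tB has degree at most dim M, so
   the coranks at the q rational values of t exceed g by at most dim M in
   total. On the other hand, if f(t) is killed by (A + tB)^j, expanding
   f(u) (A + uB)^j = 0 around u = t shows that f(t) B^j lies in the image of
   A + tB; hence rank (A + tB)^j - rank (A + tB)^(j+1) >= g - j e, and summing
   over j < m yields dim M + C(m, 2) e >= m g.

   Choosing m = min (q, N / e), where N is the least dimension of a member of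
   the pencil, gives dim M >= N^2 / (4 e) or dim M >= q N / 4. By induction on
   the dimension j of rational linear subspaces, the section by some hyperplane
   of a given subspace U of dimension j + 1 has dimension N with
   dim M_U >= c min (N^((j+1)/j), q N), and one climbs from k up to n. *)

Set Implicit Arguments.
Unset Strict Implicit.
Unset Printing Implicit Defensive.

Import Order.TTheory GRing.Theory Num.Theory.
Local Open Scope ring_scope.

Local Notation "x %:X" := (FracField.tofrac x) (at level 2, format "x %:X").

(** * Pencils of commuting matrices *)

(** Matrices act on row vectors from the right, so g = [s - \rank L] and e = [s - \rank (L + B)] are
    dimensions of cokernels. Each factor [B] lowers the rank on the cokernel of [L] by at most e.
    The image of [L] and the kernel of [L ^+ j] are both killed by [B ^+ j *m cokermx L], of rank at
    least g - j e, so the rank drops by at least g - j e from [L ^+ j] to [L ^+ j.+1]; the sum over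
    j < m gives the binomial coefficient. *)
Lemma rank_expmx_pencil (K : fieldType) (s : nat) (L B : 'M[K]_s) :
    GRing.comm L B ->
    (forall j, kermx (L ^+ j) *m (B ^+ j *m cokermx L) = 0) ->
  forall m, (m * (s - \rank L) <=
             'C(m, 2) * (s - \rank (L + B)%MS) + (s - \rank (L ^+ m)))%N.
Proof.
move=> cLB kerL.
have rankBC j : (s - \rank L <= \rank (B ^+ j *m cokermx L)
                                + j * (s - \rank (L + B)%MS))%N.
  elim: j => [|j IHj]; first by rewrite expr0 mul1mx mxrank_coker mul0n addn0.
  apply: leq_trans IHj _; rewrite mulSn addnA leq_add2r.
  set Y := B ^+ j *m cokermx L.
  have LY : L *m Y = 0.
    have := commrX j cLB; rewrite /GRing.comm => cLBj.
    by rewrite mulmxA [L *m _]cLBj -mulmxA mulmx_coker mulmx0.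
  have BY : B ^+ j.+1 *m cokermx L = B *m Y.
    by rewrite exprS -mulmxE -mulmxA.
  (* As [L] kills [Y], [B] and [L + B] have the same image under [Y]; hence one more factor [B]
     costs at most the corank of [L + B]. *)
  rewrite BY; have := mxrank_mul_min (L + B)%MS Y.
  have -> : \rank ((L + B)%MS *m Y) = \rank (B *m Y).
    by rewrite addsmxMr LY adds0mx.
  have := rank_leq_row (L + B)%MS; lia.
have step j : (\rank (L ^+ j.+1) + (s - \rank L) <=
               \rank (L ^+ j) + j * (s - \rank (L + B)%MS))%N.
  have := mxrank_mul_ker L (L ^+ j); rewrite mulmxE -exprS.
  set X := kermx (L ^+ j) => rkmul.
  have rkX : \rank X = (s - \rank (L ^+ j))%N by rewrite mxrank_ker.
  have := mxrank_sum_cap L X => rkcap.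
  have: (\rank (L + X)%MS <= s - \rank (B ^+ j *m cokermx L))%N.
    rewrite -mxrank_ker; apply: mxrankS; rewrite addsmx_sub.
    apply/andP; split; apply/sub_kermxP; last exact: kerL.
    have := commrX j cLB; rewrite /GRing.comm => cLBj.
    by rewrite mulmxA [L *m _]cLBj -mulmxA mulmx_coker mulmx0.
  have := rankBC j; have := rank_leq_row L; have := rank_leq_row (L ^+ j).
  have := rank_leq_row (B ^+ j *m cokermx L).
  lia.
elim=> [|m IHm]; first by rewrite mul0n.
have := step m; have := rank_leq_row (L ^+ m); have := rank_leq_row (L ^+ m.+1).
rewrite binS bin1 mulSn; lia.
Qed.

Lemma tofrac_frac (R : idomainType) (x : {fraction R}) :
  (\d_(repr x))%:X * x = (\n_(repr x))%:X.
Proof.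
unlock FracField.tofrac; rewrite -[x in LHS]reprK -[LHS]FracField.pi_mul.
apply/eqP; rewrite FracField.equivf_def /FracField.mulf reprK.
have d0 := denom_ratioP (repr x).
by rewrite !numden_Ratio ?mul1r ?mulr1 ?oner_neq0.
Qed.
Lemma common_denominator (D : idomainType) (m n : nat)
    (x : 'M[{fraction D}]_(m, n)) :
  exists2 d : D, d != 0 & exists y : 'M[D]_(m, n),
    d%:X *: x = map_mx (@FracField.tofrac D) y.
Proof.
pose den (p : 'I_m * 'I_n) := \d_(repr (x p.1 p.2)).
exists (\prod_p den p); first by apply/prodf_neq0 => p _; exact: denom_ratioP.
exists (\matrix_(i, j) (\n_(repr (x i j)) * \prod_(p | p != (i, j)) den p)).
apply/matrixP=> i j; rewrite !mxE (bigD1 (i, j)) //= !rmorphM /= -tofrac_frac.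
by rewrite mulrAC.
Qed.

Lemma expmx_addZ (R : comNzRingType) (s : nat) (U V : 'M[R]_s) (z : R) (j : nat) :
    U *m V = V *m U ->
  exists W, (U + z *: V) ^+ j = W *m U + z ^+ j *: V ^+ j.
Proof.
move=> cUV; elim: j => [|j [W IHj]].
  by exists 0; rewrite mul0mx add0r scale1r.
exists (W *m (U + z *: V) + z ^+ j *: V ^+ j).
rewrite exprSr IHj -mulmxE mulmxDl [in RHS]mulmxDl !mulmxDr mulmxDl.
rewrite -!scalemxAr -!scalemxAl -!mulmxA cUV mulmxE -exprSr scalerA -exprS.
by rewrite !addrA.
Qed.

(* Here Y = f(X) is killed by (A + XB)^j = (L + (X - t)B)^j, where L = A + tB.
   Modulo the image of L only the last term of the binomial expansion survives,
   so that (X - t)^j, and then X - t itself, can be eliminated. *)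
Lemma kermx_deform (K : fieldType) (s p m : nat) (L B : 'M[K]_s)
    (C : 'M[K]_(s, p)) (t : K) (Y : 'M[{poly K}]_(m, s)) (j : nat) :
    L *m B = B *m L -> L *m C = 0 ->
    Y *m (map_mx polyC L + ('X - t%:P) *: map_mx polyC B) ^+ j = 0 ->
  map_mx (horner_eval t) Y *m (B ^+ j *m C) = 0.
Proof.
move=> cLB LC YL.
have cLBp : map_mx polyC L *m map_mx polyC B = map_mx polyC B *m map_mx polyC L.
  by rewrite -!map_mxM cLB.
have [W LjE] := expmx_addZ ('X - t%:P) j cLBp.
have: Y *m (map_mx polyC L + ('X - t%:P) *: map_mx polyC B) ^+ j *m
      map_mx polyC C = 0 by rewrite YL mul0mx.
rewrite LjE mulmxDr mulmxDl -!mulmxA -map_mxM LC map_mx0 !mulmx0 add0r.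
rewrite -scalemxAl -scalemxAr -rmorphXn -map_mxM => /matrixP YBC.
have {}YBC : Y *m map_mx polyC (B ^+ j *m C) = 0.
  apply/matrixP=> i k; have /eqP := YBC i k; rewrite !mxE mulf_eq0.
  by rewrite expf_eq0 polyXsubC_eq0 andbF /= => /eqP.
have /(congr1 (map_mx (horner_eval t))) := YBC.
rewrite map_mx0 map_mxM -map_mx_comp => <-; congr (_ *m _).
by apply/matrixP=> i k; rewrite !mxE /= /horner_eval hornerC.
Qed.

Definition frac_const (F : fieldType) : {rmorphism F -> {fraction {poly F}}} :=
  (@FracField.tofrac _) \o polyC.

(* The generic member A + tB of a pencil, over the field of fractions of F[t]. *)
Definition pencil (F : fieldType) (s : nat) (A B : 'M[F]_s) :
    'M[{fraction {poly F}}]_s :=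
  map_mx (frac_const F) A + ('X)%:X *: map_mx (frac_const F) B.

(** This turns f(u), with coefficients read as constants of F(t), back into f(t) by setting u =
    t. *)
Lemma horner_frac_const (F : fieldType) (p : {poly F}) :
  (map_poly (frac_const F) p).[('X)%:X] = p%:X.
Proof.
elim/poly_ind: p => [|p c IHp]; first by rewrite !rmorph0 horner0.
rewrite !rmorphD !rmorphM /= map_polyX map_polyC /= hornerD hornerM hornerX.
by rewrite hornerC IHp.
Qed.

(** Clearing denominators makes the kernel polynomial in t; [psi] renames t to a new variable u over
    F(t), and [kermx_deform] applies at u = t because A + uB = (A + tB) + (u - t)B. *)
Lemma kermx_pencil (F : fieldType) (s : nat) (A B : 'M[F]_s) (j : nat) :
    A *m B = B *m A ->
  let b := map_mx (frac_const F) B in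
  kermx (pencil A B ^+ j) *m (b ^+ j *m cokermx (pencil A B)) = 0.
Proof.
move=> cAB b; pose K : fieldType := {fraction {poly F}}.
set L := pencil A B.
pose a := map_mx (frac_const F) A.
have cab : a *m b = b *m a by rewrite -!map_mxM cAB.
have [d d0 [Y dX]] := common_denominator (kermx (L ^+ j)).
set X := kermx (L ^+ j) in dX *.
pose Lp := map_mx polyC A + 'X *: map_mx polyC B.
have LpE : map_mx (@FracField.tofrac _) Lp = L.
  by rewrite map_mxD map_mxZ -!map_mx_comp.
have tofrac_inj : injective (@FracField.tofrac {poly F}).
  by move=> x y /eqP; rewrite tofrac_eq => /eqP.
have YL : Y *m Lp ^+ j = 0.
  have: map_mx (@FracField.tofrac _) (Y *m Lp ^+ j) = 0.
    by rewrite map_mxM rmorphXn /= LpE -dX -scalemxAl mulmx_ker scaler0.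
  move=> /matrixP YL; apply/matrixP=> i k; apply: tofrac_inj.
  by have := YL i k; rewrite !mxE => ->; rewrite tofrac0.
pose psi : {rmorphism {poly F} -> {poly K}} := map_poly (frac_const F).
have psiLp : map_mx psi Lp =
    map_mx polyC L + ('X - ('X)%:X%:P) *: map_mx polyC b.
  apply/matrixP=> i k; rewrite !mxE /= rmorphD rmorphM /= map_polyX !map_polyC /=.
  by rewrite polyCD polyCM mulrBl -addrA [X in _ = _ + X]addrC subrK.
have cLb0 : L *m b = b *m L.
  rewrite /L /pencil -/a -/b mulmxDl [RHS]mulmxDr cab; congr (_ + _).
  by rewrite -scalemxAl -scalemxAr.
have LC : L *m cokermx L = 0 by rewrite mulmx_coker.
have YpsiL : map_mx psi Y *m
    (map_mx polyC L + ('X - ('X)%:X%:P) *: map_mx polyC b) ^+ j = 0.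
  by rewrite -psiLp -rmorphXn -map_mxM YL map_mx0.
have := kermx_deform cLb0 LC YpsiL.
have -> : map_mx (horner_eval ('X)%:X) (map_mx psi Y) = d%:X *: X.
  by rewrite dX; apply/matrixP=> i k; rewrite !mxE /= /horner_eval horner_frac_const.
rewrite -scalemxAl => /matrixP dXbC; apply/matrixP=> i k.
have /eqP := dXbC i k; rewrite !mxE mulf_eq0 tofrac_eq0 (negPf d0) /=.
by move/eqP.
Qed.

Lemma exists_minor_unit (F : fieldType) (m n : nat) (A : 'M[F]_(m, n)) :
  exists (f : 'I_(\rank A) -> 'I_m) (g : 'I_(\rank A) -> 'I_n),
    mxsub f g A \in unitmx.
Proof.
pose A1 := rowsub (maxrankfun A) A.
have A1T : row_full A1^T by rewrite /row_full mxrank_tr; exact: maxrowsub_free.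
exists (maxrankfun A), (fullrankfun A1T).
rewrite -unitmx_tr.
suff -> : (mxsub (maxrankfun A) (fullrankfun A1T) A)^T =
          rowsub (fullrankfun A1T) A1^T by exact: fullrowsub_unit.
by apply/matrixP=> i j; rewrite !mxE.
Qed.

Lemma mxrank_mxsub_le (F : fieldType) (m n m' n' : nat) (A : 'M[F]_(m, n))
    (f : 'I_m' -> 'I_m) (g : 'I_n' -> 'I_n) :
  (\rank (mxsub f g A) <= \rank A)%N.
Proof.
have -> : mxsub f g A = rowsub f (colsub g A).
  by apply/matrixP=> i j; rewrite !mxE.
apply: leq_trans (mxrankS (rowsub_sub _ _)) _.
have -> : colsub g A = (rowsub g A^T)^T by apply/matrixP=> i j; rewrite !mxE.
by rewrite mxrank_tr -[in leqRHS]mxrank_tr; apply/mxrankS/rowsub_sub.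
Qed.

(* Gaussian elimination at t makes all rows of P but \rank (P t) divisible by
   X - t. *)
Lemma dvdp_det (F : fieldType) (r : nat) (P : 'M[{poly F}]_r) (t : F) :
  ('X - t%:P) ^+ (r - \rank (map_mx (horner_eval t) P)) %| \det P.
Proof.
set M := map_mx _ P; set k := \rank M.
pose U := invmx (col_ebase M).
have UM : U *m M = pid_mx k *m row_ebase M.
  by rewrite -[M in LHS]mulmx_ebase !mulmxA mulVmx ?col_ebase_unit // mul1mx.
pose P' := map_mx polyC U *m P.
(* The exponent is a boolean: [w i] is X - t for the rows that vanish at t, and 1 for the first [k]
   rows. *)
pose w (i : 'I_r) : {poly F} := ('X - t%:P) ^+ (k <= i)%N.
have wP' i j : w i %| P' i j.
  rewrite /w; case: leqP => [ki|_]; last by rewrite expr0 dvd1p.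
  rewrite expr1 dvdp_XsubCl /root.
  have -> : (P' i j).[t] = (map_mx (horner_eval t) P') i j by rewrite [RHS]mxE.
  rewrite /P' map_mxM -map_mx_comp.
  have -> : map_mx (horner_eval t \o polyC) U = U.
    by apply/matrixP=> a b; rewrite !mxE /= /horner_eval hornerC.
  rewrite UM mxE big1 // => l _; rewrite mxE.
  by rewrite (leq_gtF ki) andbF mul0r.
pose Q := \matrix_(i, j) (P' i j %/ w i).
have P'E : P' = diag_mx (\row_i w i) *m Q.
  apply/matrixP=> i j; rewrite mul_diag_mx [RHS]mxE [in RHS]mxE /Q [in RHS]mxE.
  by rewrite mulrC divpK.
have detw : \det P' = ('X - t%:P) ^+ (r - k) * \det Q.
  rewrite P'E det_mulmx det_diag; congr (_ * _).
  under eq_bigr do rewrite mxE /w.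
  rewrite prodrXr; congr (_ ^+ _).
  rewrite -(big_mkord xpredT (fun i => (k <= i)%N : nat)) /=.
  rewrite (@big_cat_nat _ _ _ k) ?rank_leq_row //=.
  rewrite big_nat_cond big1 => [|i /andP[/andP[_ ik] _]]; last by rewrite leqNgt ik.
  rewrite add0n big_nat_cond (eq_bigr (fun=> 1%N)) => [|i /andP[/andP[ki _] _]].
    by rewrite -big_nat_cond sum_nat_const_nat muln1.
  by rewrite ki.
have detU : \det U != 0.
  by rewrite -unitfE -unitmxE unitmx_inv col_ebase_unit.
have : ('X - t%:P) ^+ (r - k) %| \det P' by rewrite detw dvdp_mulr.
by rewrite /P' det_mulmx det_map_mx /= mul_polyC dvdpZr.
Qed.

Lemma size_det_linear (F : fieldType) (r : nat) (P : 'M[{poly F}]_r) :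
  (forall i j, size (P i j) <= 2)%N -> (size (\det P) <= r.+1)%N.
Proof.
move=> sP; apply: (big_ind (fun p : {poly F} => size p <= r.+1)%N).
- by rewrite size_poly0.
- by move=> p q sp sq; rewrite (leq_trans (size_polyD _ _)) // geq_max sp.
move=> u _; pose p := \prod_i P i (u i).
have -> : size ((-1) ^+ u * p) = size p.
  case: (odd_perm u); rewrite ?expr0 ?mul1r //.
  by rewrite expr1 mulN1r size_polyN.
have := size_prod_leq xpredT (fun i => P i (u i)); rewrite cardT size_enum_ord.
rewrite -/p.
have : (\sum_(i < r) size (P i (u i)) <= \sum_(i < r) 2)%N by apply: leq_sum.
rewrite sum_nat_const card_ord => sum2 /leq_trans -> //.
by rewrite leq_subLR addnS ltnS addnn -muln2.
Qed.

Lemma dvdp_prod_XsubC (F : fieldType) (e : F -> nat) (p : {poly F}) (s : seq F) :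
    uniq s -> (forall t, ('X - t%:P) ^+ e t %| p) ->
  \prod_(t <- s) ('X - t%:P) ^+ e t %| p.
Proof.
move=> us ep; elim: s us => [|t s IHs] /=; first by rewrite big_nil dvd1p.
case/andP=> ts /IHs ps; rewrite big_cons Gauss_dvdp ?ep ?ps //.
rewrite big_seq; apply: (big_ind (coprimep _)) => [|x y cx cy|x xs].
- exact: coprimep1.
- by rewrite coprimepMr cx.
apply/coprimep_expl/coprimep_expr; rewrite coprimep_XsubC root_XsubC.
by apply: contraNneq ts => <-.
Qed.

(** A nonzero minor of order r, the generic rank, has degree at most r in t. It is divisible by the
    coprime factors (X - t)^(r - rank (A + tB)), so these defects sum to at most r. *)
Lemma sum_rank_pencil (F : finFieldType) (s : nat) (A B : 'M[F]_s) :
  (#|F| * \rank (pencil A B) <=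
   \rank (pencil A B) + \sum_(t : F) \rank (A + t *: B)%R)%N.
Proof.
have [f [g unitP]] := exists_minor_unit (pencil A B).
set r := \rank _ in f g unitP *.
pose P := mxsub f g (map_mx polyC A + 'X *: map_mx polyC B).
have detP : \det P != 0.
  rewrite -tofrac_eq0 -det_map_mx; rewrite unitmxE unitfE in unitP.
  suff -> : map_mx (@FracField.tofrac _) P = mxsub f g (pencil A B) by [].
  by apply/matrixP=> i j; rewrite !mxE /= rmorphD rmorphM.
have sdet : (size (\det P) <= r.+1)%N.
  apply: size_det_linear => i j; rewrite !mxE.
  apply: (leq_trans (size_polyD _ _)); rewrite geq_max; apply/andP; split.
    by apply: leq_trans (size_polyC_leq1 _) _.
  apply: leq_trans (size_polyMleq _ _) _; rewrite size_polyX.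
  by rewrite add2n ltnS size_polyC_leq1.
pose e t := (r - \rank (map_mx (horner_eval t) P))%N.
have dvd := dvdp_prod_XsubC (enum_uniq F) (dvdp_det P).
have := leq_trans (dvdp_leq detP dvd) sdet.
rewrite size_prod_seq; last by move=> t _; rewrite expf_neq0 // polyXsubC_eq0.
have -> : (\sum_(t <- enum F) size (('X - t%:P) ^+ e t) =
           #|F| + \sum_(t <- enum F) e t)%N.
  under eq_bigr do rewrite size_exp_XsubC -addn1.
  by rewrite big_split /= sum1_size -cardE addnC.
have -> : (\sum_(t <- enum F) e t = \sum_t e t)%N.
  by rewrite big_enum; apply: eq_bigl.
have rke t : (r <= e t + \rank (A + t *: B)%R)%N.
  rewrite /e.
  suff : (\rank (map_mx (horner_eval t) P) <= \rank (A + t *: B)%R)%N by lia.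
  have -> : map_mx (horner_eval t) P = mxsub f g (A + t *: B).
    apply/matrixP=> i j; rewrite !mxE /= /horner_eval.
    by rewrite hornerD hornerM hornerX !hornerC.
  exact: mxrank_mxsub_le.
have : (\sum_(t : F) r <= \sum_(t : F) (e t + \rank (A + t *: B)%R))%N.
  by apply: leq_sum.
rewrite big_split /= sum_nat_const (eq_card (B := F)) //.
move: (\sum_t e t)%N (\sum_t \rank _)%N => Se Sr.
rewrite -cardE -addnS addKn ltnS => qr Sr_le.
by rewrite (leq_trans qr) ?leq_add2r.
Qed.

(** With g the generic corank, averaging over the q values of t gives q N <= q g + s, while
    [rank_expmx_pencil] bounds m g. The term [2 * s] collects the corank of the m-th power and m s /
    q, each at most s because m <= q. *)
Lemma corank_pencil_bound (F : finFieldType) (s m N : nat) (A B : 'M[F]_s) :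
    A *m B = B *m A -> (m <= #|F|)%N ->
    (forall t : F, N <= s - \rank (A + t *: B)%R)%N ->
  (m * N <= 'C(m, 2) * (s - \rank (A + B)%MS) + 2 * s)%N.
Proof.
move=> cAB mq corkN.
set b := map_mx (frac_const F) B.
have cLb : GRing.comm (pencil A B) b.
  rewrite /GRing.comm -mulmxE /pencil -/b mulmxDl mulmxDr -scalemxAl -scalemxAr.
  by rewrite -!map_mxM cAB.
have := rank_expmx_pencil cLb (fun j => kermx_pencil j cAB) m.
have -> : \rank (pencil A B + b)%MS = \rank (A + B)%MS.
  rewrite -[RHS](mxrank_map (frac_const F)) map_addsmx; apply: eqmx_rank.
  rewrite !addsmx_sub !addsmxSr !andbT /pencil -/b; apply/andP; split.
    by rewrite addmx_sub_adds // scalemx_sub.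
  rewrite -[X in (X <= _)%MS](addrK (('X)%:X *: b)).
  by rewrite addmx_sub_adds // eqmx_opp scalemx_sub.
have Ns : (N <= s)%N by apply: leq_trans (corkN 0) (leq_subr _ _).
have rk_le t : (\rank (A + t *: B)%R <= s - N)%N.
  by have := corkN t; have := rank_leq_row (A + t *: B)%R; lia.
have := sum_rank_pencil A B.
have : (\sum_(t : F) \rank (A + t *: B)%R <= \sum_(t : F) (s - N))%N.
  by apply: leq_sum => t _; exact: rk_le.
rewrite sum_nat_const (eq_card (B := F)) //.
have q0 : (0 < #|F|)%N by apply/card_gt0P; exists 0.
have := rank_leq_row (pencil A B).
move: (\sum_t _)%N (\rank (pencil A B)) (s - \rank (A + B)%MS)%N (\rank (_ ^+ m)).
move=> S r e' r'.
move: q0 mq; move: #|F| => q q0 mq rs S1 S2 main.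
have qN : (q * N <= q * (s - r) + s)%N.
  by rewrite -(leq_add2r (q * (s - N) + q * r)%N); nia.
have mqN : (m * (q * N) <= m * (q * (s - r) + s))%N.
  by rewrite leq_mul2l qN orbT.
rewrite -(leq_pmul2l q0); nia.
Qed.

(** The previous bound is transported to the quotient of F^s by the stable subspace [I]: [P] is the
    projection, [T] a section of it, and [T *m Z *m P] the operator that [Z] induces. *)
Lemma corank_pencil_bound_rel (F : finFieldType) (s m N : nat) (I A B : 'M[F]_s) :
    A *m B = B *m A -> (I *m A <= I)%MS -> (I *m B <= I)%MS -> (m <= #|F|)%N ->
    (forall t : F, N <= s - \rank (I + (A + t *: B)%R)%MS)%N ->
  (m * N <= 'C(m, 2) * (s - \rank (I + (A + B))%MS) + 2 * (s - \rank I))%N.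
Proof.
move=> cAB IA IB mq corkN.
have [e [P [eE Pfull kerP]]] : exists e, exists P : 'M[F]_(s, e),
    [/\ e = (s - \rank I)%N, row_full P &
        forall n (Z : 'M_(n, s)), (Z <= I)%MS = (Z *m P == 0)].
  exists (\rank (cokermx I)), (col_base (cokermx I)).
  split; [by rewrite mxrank_coker | exact: col_base_full |].
  move=> n Z; rewrite submxE -[RHS](mulmx_free_eq0 _ (row_base_free _)).
  by rewrite -mulmxA mulmx_base.
have [T TP] : exists T, T *m P = 1%:M by exists (pinvmx P); apply: mulVpmx.
have desc (Z : 'M_s) : (I *m Z <= I)%MS -> P *m (T *m Z *m P) = Z *m P.
  move=> IZ; apply/eqP; rewrite eq_sym -subr_eq0.
  have -> : Z *m P - P *m (T *m Z *m P) = (1%:M - P *m T) *m Z *m P.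
    by rewrite !mulmxBl mul1mx !mulmxA.
  rewrite -kerP; apply: submx_trans IZ; apply: submxMr.
  by rewrite kerP mulmxBl mul1mx -mulmxA TP mulmx1 subrr.
pose A' := T *m A *m P; pose B' := T *m B *m P.
have cAB' : A' *m B' = B' *m A'.
  by rewrite /A' -[LHS]mulmxA desc // /B' -[RHS]mulmxA desc // !mulmxA
    -[T *m A *m B]mulmxA cAB !mulmxA.
have rkP (Z : 'M_s) : (s - \rank (I + Z)%MS = e - \rank (Z *m P))%N.
  have -> : (e - \rank (Z *m P) = s - (\rank I + \rank (Z *m P)))%N.
    by rewrite [in RHS]subnDA -eE.
  congr (_ - _)%N; rewrite -(mxrank_mul_ker (I + Z)%MS P).
  have kerI : (kermx P :=: I)%MS.
    by apply/eqmxP; rewrite kerP mulmx_ker eqxx /= sub_kermx -kerP.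
  rewrite (cap_eqmx (eqmx_refl _) kerI) addnC (capmx_idPr (addsmxSl _ _)).
  congr (_ + _)%N; rewrite addsmxMr.
  have /eqP -> : I *m P == 0 by rewrite -kerP.
  by rewrite adds0mx.
have AP : A *m P = P *m A' by rewrite desc.
have BP : B *m P = P *m B' by rewrite desc.
rewrite rkP addsmxMr -eE.
have -> : \rank (A *m P + B *m P)%MS = \rank (A' + B')%MS.
  have eqP := adds_eqmx (eqmxMfull A' Pfull) (eqmxMfull B' Pfull).
  by rewrite AP BP; apply: eqmx_rank; rewrite !eqP submx_refl.
apply: corank_pencil_bound => // t; apply: leq_trans (corkN t) _.
rewrite rkP mulmxDl -scalemxAl AP BP scalemxAr -mulmxDr.
by rewrite (eqmxMfull _ Pfull).
Qed.

(** * Sections by linear subspaces *)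

Lemma rank_adds_row (F : fieldType) (m n : nat) (A : 'M[F]_(m, n)) (v : 'rV_n) :
  ~~ (v <= A)%MS -> \rank (A + v)%MS = (\rank A).+1.
Proof.
move=> vA; apply/eqP; rewrite eqn_leq; apply/andP; split.
  apply: leq_trans (mxrank_adds_leqif A v) _.
  by have := rank_leq_row v; lia.
have: (A < A + v)%MS by rewrite ltmxE addsmxSl addsmx_sub negb_and vA orbT.
by rewrite ltmxErank => /andP[].
Qed.

Lemma rank_succ_adds_row (F : fieldType) (m n : nat) (A : 'M[F]_(m, n))
    (B : 'M_n) : (A <= B)%MS -> \rank B = (\rank A).+1 ->
  exists2 v : 'rV_n, ~~ (v <= A)%MS & (A + v :=: B)%MS.
Proof.
move=> AB rB; have [|i iA] := row_subPn (_ : ~~ (B <= A)%MS).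
  by apply/negP=> /mxrankS; rewrite rB ltnn.
exists (row i B) => //; apply/eqmxP.
rewrite -(eq_leqif (mxrank_leqif_eq _)) ?rank_adds_row ?rB //.
by rewrite addsmx_sub AB row_sub.
Qed.

Section LinearSections.

Variables (F : fieldType) (n s : nat) (G : 'I_n -> 'M[F]_s).

Definition lin_comb (v : 'rV[F]_n) : 'M[F]_s := \sum_j v 0 j *: G j.

(* The submodule (l_1, ..., l_m) M, where the l_i are the rows of A. *)
Definition sect m (A : 'M[F]_(m, n)) : 'M[F]_s :=
  (\sum_(i < m) lin_comb (row i A))%MS.

(** The dimension of M / (l_1, ..., l_m) M. The rows of [A] are equations, so [\rank A + j = n]
    below means a section by a linear subspace of dimension j. *)
Definition cosect m (A : 'M[F]_(m, n)) : nat := s - \rank (sect A).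

Lemma lin_combD u v : lin_comb (u + v) = lin_comb u + lin_comb v.
Proof. by rewrite -big_split; apply: eq_bigr => j _; rewrite mxE scalerDl. Qed.

Lemma lin_combZ c v : lin_comb (c *: v) = c *: lin_comb v.
Proof. by rewrite scaler_sumr; apply: eq_bigr => j _; rewrite mxE scalerA. Qed.

Lemma lin_comb_sub m (A : 'M[F]_(m, n)) v :
  (v <= A)%MS -> (lin_comb v <= sect A)%MS.
Proof.
case/submxP=> D ->; rewrite mulmx_sum_row.
have lin0 : lin_comb 0 = 0 by rewrite -(scale0r 0) lin_combZ scale0r.
rewrite (big_morph lin_comb lin_combD lin0); apply: summx_sub => i _.
by rewrite lin_combZ scalemx_sub // (sumsmx_sup i).
Qed.

Lemma sectS m1 m2 (A : 'M[F]_(m1, n)) (B : 'M[F]_(m2, n)) :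
  (A <= B)%MS -> (sect A <= sect B)%MS.
Proof.
move=> AB; apply/sumsmx_subP => i _; apply: lin_comb_sub.
exact: submx_trans (row_sub i A) AB.
Qed.

Lemma cosect_eqmx m1 m2 (A : 'M[F]_(m1, n)) (B : 'M[F]_(m2, n)) :
  (A :=: B)%MS -> cosect A = cosect B.
Proof.
move=> AB; congr (_ - _)%N; apply: eqmx_rank.
by rewrite !sectS ?AB.
Qed.

Lemma sect_adds m (A : 'M[F]_(m, n)) v :
  (sect (A + v)%MS :=: sect A + lin_comb v)%MS.
Proof.
apply/eqmxP; rewrite [X in _ && X]addsmx_sub sectS ?addsmxSl //=.
rewrite lin_comb_sub ?addsmxSr // andbT.
apply/sumsmx_subP => i _; have := row_sub i (A + v)%MS.
case/sub_addsmxP=> -[D c] /= ->; rewrite lin_combD addmx_sub_adds //.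
  by rewrite lin_comb_sub // submxMl.
by rewrite [c]mx11_scalar mul_scalar_mx lin_combZ scalemx_sub.
Qed.

Hypothesis commG : forall i j, G i *m G j = G j *m G i.

Lemma lin_combC u v : lin_comb u *m lin_comb v = lin_comb v *m lin_comb u.
Proof.
rewrite !mulmx_suml; under eq_bigr do rewrite mulmx_sumr.
rewrite exchange_big; apply: eq_bigr => i _; rewrite mulmx_sumr.
apply: eq_bigr => j _; rewrite -!scalemxAl -!scalemxAr commG !scalerA.
by rewrite [_ * u 0 j]mulrC.
Qed.

Lemma sect_lin_comb m (A : 'M[F]_(m, n)) v : (sect A *m lin_comb v <= sect A)%MS.
Proof.
rewrite sumsmxMr; apply: sumsmxS => i _.
by rewrite lin_combC submxMl.
Qed.

End LinearSections.

(* S, N0 and N1 are the dimensions of the sections by the members of a flag of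
   subspaces of dimensions k + 2, k + 1 and k. *)
Lemma growth_arith (q N0 N1 S C k : nat) : (0 < C)%N ->
    (forall m, (m <= q)%N -> m * N0 <= 'C(m, 2) * N1 + 2 * S)%N ->
    (N1 ^ k.+1 <= C * N0 ^ k)%N \/ (q * N1 <= C * N0)%N ->
  (N0 ^ k.+2 <= 4 ^ k.+1 * C * S ^ k.+1)%N \/ (q * N0 <= 4 ^ k.+1 * C * S)%N.
Proof.
move=> C0 pen IH.
have C4 : (4 <= 4 ^ k.+1 * C)%N.
  by rewrite expnS -mulnA leq_pmulr // muln_gt0 expn_gt0.
have [->|N0_gt0] := posnP N0; first by left; rewrite exp0n.
(* For [N1 = 0] the quotient [N0 %/ N1] would be 0 by convention; the quadratic term being absent, m
   = q can be taken instead. *)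
have [N1_0|N1_gt0] := posnP N1.
  right; apply: leq_trans (pen q (leqnn q)) _; rewrite N1_0 muln0 add0n.
  by rewrite leq_mul2r (leq_trans _ C4) ?orbT.
have [->|q_gt0] := posnP q; first by right.
pose m := minn q (N0 %/ N1).
(* Since m N1 <= N0, twice the binomial term is at most (m - 1) N0, which leaves 2m - (m - 1) = m +
   1 copies of N0; m = 0 uses the bound at 1. The extra 1 compensates for the rounding in
   [N0 %/ N1]. *)
have mN : (m.+1 * N0 <= 4 * S)%N.
  have mN1 : (m * N1 <= N0)%N.
    by apply: leq_trans (leq_divM N0 N1); rewrite leq_mul2r geq_minr orbT.
  have := pen m (geq_minl _ _).
  have : (N0 <= 2 * S)%N by have := pen 1%N q_gt0; rewrite bin_small // mul1n.
  have bin : ('C(m, 2) * 2 = m * m.-1)%N.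
    by rewrite (bin_ffact m 2) ffactnS ffactn1.
  have b2 : ('C(m, 2) * 2 * N1 <= m.-1 * N0)%N.
    by rewrite bin [(m * _)%N]mulnC -mulnA leq_mul2l mN1 orbT.
  move: b2; rewrite mulnAC; move: ('C(m, 2) * N1)%N => X.
  by case: (m) => [|m'] /=; rewrite ?mulSn; lia.
have [qm|] := leqP q (N0 %/ N1).
  right; move: mN; rewrite /m (minn_idPl qm) => h.
  apply: leq_trans (_ : 4 * S <= _)%N.
    by apply: leq_trans h; rewrite leq_mul2r leqnSn orbT.
  by rewrite leq_mul2r C4 orbT.
move=> /ltnW mq; rewrite /m (minn_idPr mq) in mN.
have sq : (N0 * N0 <= 4 * S * N1)%N.
  have := ltn_ceil N0 N1_gt0 => h.
  apply: leq_trans (_ : (N0 %/ N1).+1 * N0 * N1 <= _)%N; last first.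
    by rewrite leq_mul2r mN orbT.
  by rewrite mulnAC leq_mul2r ltnW ?orbT.
(* In the first case [sq] is raised to the power k + 1 and N0^k is cancelled; in the second it is
   multiplied by q and N0 is cancelled. *)
case: IH => [h|h].
  left; rewrite -(leq_pmul2r (_ : 0 < N0 ^ k)%N) ?expn_gt0 ?N0_gt0 //.
  rewrite -expnD (_ : k.+2 + k = 2 * k.+1)%N; last by lia.
  rewrite expnM -mulnn.
  apply: leq_trans (_ : (4 * S * N1) ^ k.+1 <= _)%N; first by rewrite leq_exp2r.
  rewrite !expnMn; move: h.
  move: (4 ^ k.+1)%N (S ^ k.+1)%N (N1 ^ k.+1)%N (N0 ^ k)%N => a b c d h.
  rewrite -!mulnA leq_mul2l; apply/orP; right.
  by rewrite [leqRHS]mulnCA leq_mul2l h orbT.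
right; rewrite -(leq_pmul2r N0_gt0).
apply: leq_trans (_ : 4 * S * (C * N0) <= _)%N.
  rewrite -mulnA; apply: leq_trans (_ : q * (4 * S * N1) <= _)%N.
    by rewrite leq_mul2l sq orbT.
  by rewrite mulnCA leq_mul2l h orbT.
rewrite expnS; move: (4 ^ k)%N (expn_gt0 4 k) => e; nia.
Qed.

(** [A] cuts out a subspace U of dimension k + 1, and [B] a hyperplane of U with the smallest
    section. Induction gives a hyperplane [D] of the latter; the hyperplanes of U with equation u +
    t v contain it and, by minimality, have sections no smaller than that of [B], so the pencil
    bound and [growth_arith] apply. For k = 0, [B] cuts out the origin. *)
Lemma cosect_growth (k : nat) :
  exists2 C, (0 < C)%N &
  forall (F : finFieldType) (n s : nat) (G : 'I_n -> 'M[F]_s),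
    (forall i j, G i *m G j = G j *m G i) ->
    (cosect G 1%:M <= 1)%N ->
  forall A : 'M[F]_n, (\rank A + k.+1 = n)%N ->
  exists B : 'M[F]_n, [/\ (A <= B)%MS, \rank B = (\rank A).+1 &
    (cosect G B ^ k.+1 <= C * cosect G A ^ k)%N \/
    (#|F| * cosect G B <= C * cosect G A)%N].
Proof.
elim: k => [|k [C C0 IHk]].
  exists 1%N => // F n s G cG G1 A rA; exists 1%:M; split.
  - exact: submx1.
  - by rewrite mxrank1; lia.
  - by left; rewrite expn1 expn0 muln1.
exists (4 ^ k.+1 * C)%N; first by rewrite muln_gt0 expn_gt0.
move=> F n s G cG G1 A rA.
pose P (B : 'M[F]_n) := (A <= B)%MS && (\rank B == (\rank A).+1).
have [v0 v0A] : exists v : 'rV[F]_n, ~~ (v <= A)%MS.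
  have [|i iA] := row_subPn (_ : ~~ ((1%:M : 'M_n) <= A)%MS).
    by apply/negP=> /mxrankS; rewrite mxrank1; lia.
  by exists (row i 1%:M).
have Pv (v : 'rV_n) : ~~ (v <= A)%MS -> P (A + v)%MS.
  by move=> vA; rewrite /P addsmxSl /=; apply/eqP/rank_adds_row.
have [B /andP[AB /eqP rB] minB] := arg_minnP (@cosect _ _ _ G n) (Pv v0 v0A).
have rBn : (\rank B + k.+1 = n)%N by rewrite rB; lia.
have [D [BD rD growthBD]] := IHk F n s G cG G1 B rBn.
exists B; split=> //; apply: growth_arith C0 _ growthBD => m mq.
have [u uA AuB] := rank_succ_adds_row AB rB.
have [v vB BvD] := rank_succ_adds_row BD rD.
have -> : cosect G D =
    (s - \rank (sect G A + (lin_comb G u + lin_comb G v))%MS)%N.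
  rewrite -(cosect_eqmx G BvD) /cosect; congr (_ - _)%N.
  rewrite (sect_adds G B v) addsmxA; apply/eqmx_rank/eqmxP/adds_eqmx => //.
  apply: eqmx_trans (sect_adds G A u); apply/eqmxP.
  by rewrite !sectS ?AuB.
apply: corank_pencil_bound_rel => //; try exact: sect_lin_comb.
  exact: lin_combC.
move=> t; have uvA : ~~ ((u + t *: v)%R <= A)%MS.
  apply/negP=> uvA; have : (D <= A + v)%MS.
    rewrite -BvD addsmx_sub addsmxSr andbT -AuB addsmx_sub addsmxSl /=.
    by rewrite -[u](addrK (t *: v)) addmx_sub_adds // -scaleNr scalemx_sub.
  move/mxrankS; rewrite rD rB; apply/negP; rewrite -ltnNge ltnS.
  apply: leq_trans (mxrank_adds_leqif A v) _.
  by have := rank_leq_row v; lia.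
have := minB _ (Pv _ uvA); rewrite /cosect (sect_adds G A).
by rewrite lin_combD lin_combZ.
Qed.

(** * The associated graded module *)

(** Independently chosen projections [E d] onto [U d] need not be compatible, so [Q d] is the
    product of [E (D - 1)], ..., [E d] in this order. For d >= D the truncated difference [D - d] is
    0 and the product is empty. *)
Lemma flag_projectors (F : fieldType) (s D : nat) (U : nat -> 'M[F]_s) :
    (forall d, (U d <= U d.+1)%MS) -> (1%:M <= U D)%MS ->
  exists Q : nat -> 'M[F]_s,
    [/\ forall d, (Q d <= U d)%MS,
        forall d m (Z : 'M_(m, s)), (Z <= U d)%MS -> Z *m Q d = Z,
        forall d, Q d.+1 *m Q d = Q d &
        forall d, (D <= d)%N -> Q d = 1%:M].
Proof.
move=> US UD; pose E d := pinvmx (U d) *m U d.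
pose fix R k := if k is k'.+1 then R k' *m E (D - k)%N else 1%:M.
have UDS d : (D <= d)%N -> (1%:M <= U d)%MS.
  elim: d => [|d IHd]; first by rewrite leqn0 => /eqP D0; rewrite -D0.
  rewrite leq_eqVlt => /predU1P[<- //|/IHd /submx_trans]; exact.
have RS d : (d < D)%N -> R (D - d)%N = R (D - d.+1)%N *m E d.
  move=> dD; rewrite subnS; have : (0 < D - d)%N by rewrite subn_gt0.
  case Dd : (D - d)%N => [|k] //= _; congr (_ *m E _); lia.
have EU d m (Z : 'M_(m, s)) : (Z <= U d)%MS -> Z *m E d = Z.
  by move=> ZU; rewrite mulmxA mulmxKpV.
have RU d : (R (D - d)%N <= U d)%MS.
  have [dD|Dd] := ltnP d D; first by rewrite RS // mulmxA submxMl.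
  by have /eqP -> : (D - d == 0)%N by []; apply: UDS.
have Rid d m (Z : 'M_(m, s)) : (Z <= U d)%MS -> Z *m R (D - d)%N = Z.
  have [k kD] : exists k, k = (D - d)%N by exists (D - d)%N.
  elim: k d kD => [|k IHk] d kD ZU; first by rewrite -kD mulmx1.
  have dD : (d < D)%N by lia.
  have kE : k = (D - d.+1)%N by lia.
  have ZUS := submx_trans ZU (US d).
  by rewrite (RS _ dD) mulmxA (IHk d.+1 kE ZUS) EU.
exists (fun d => R (D - d)%N); split=> [d|d m Z|d|d Dd].
- exact: RU.
- exact: Rid.
- have [dD|Dd] := ltnP d D.
    by rewrite (RS d dD) mulmxA (Rid d.+1 _ _ (RU d.+1)).
  have -> : (D - d = 0)%N by lia.
  have -> : (D - d.+1 = 0)%N by lia.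
  by rewrite mulmx1.
by have /eqP -> : (D - d == 0)%N by [].
Qed.

Section AssociatedGraded.

Variables (F : fieldType) (n s : nat) (X : 'I_n -> 'M[F]_s) (u : 'rV[F]_s).

(** The span of all [u] times monomials of degree less than d in the [X i]; the shift by one agrees
    with [msize]. *)
Fixpoint filt (d : nat) : 'M[F]_s :=
  if d is d'.+1 then (u + (filt d' + \sum_i filt d' *m X i))%MS else 0.

Lemma filtS d : (filt d <= filt d.+1)%MS.
Proof. by rewrite /= addsmxA addsmxC addsmxA addsmxSr. Qed.

Lemma filt_le d e : (d <= e)%N -> (filt d <= filt e)%MS.
Proof.
elim: e => [|e IHe]; first by rewrite leqn0 => /eqP->.
rewrite leq_eqVlt => /predU1P[-> //|/IHe de]; exact: submx_trans de (filtS e).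
Qed.

Lemma filtX m d (Z : 'M_(m, s)) i :
  (Z <= filt d)%MS -> (Z *m X i <= filt d.+1)%MS.
Proof.
move=> Zd; apply: submx_trans (submxMr _ Zd) _.
apply: submx_trans (addsmxSr _ _); apply: submx_trans (addsmxSr _ _).
exact: (sumsmx_sup i).
Qed.

Lemma filt_lin_comb m d (Z : 'M_(m, s)) a c :
  (Z <= filt d)%MS -> (Z *m (lin_comb X a + c%:M) <= filt d.+1)%MS.
Proof.
move=> Zd; rewrite mulmxDr addmx_sub //; last first.
  by rewrite mul_mx_scalar scalemx_sub // (submx_trans Zd) // filtS.
rewrite mulmx_sumr summx_sub // => i _.
by rewrite -scalemxAr scalemx_sub // filtX.
Qed.

(** [G i] keeps only the part of [X i] that raises the degree by exactly one. Modulo the [G i] at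
    most the piece of degree 0, spanned by [u], survives. The constants [c i] do not raise degrees,
    so the graded submodule lies, degree by degree, in the leading parts of the affine one. *)
Lemma associated_graded D :
    (forall i j, X i *m X j = X j *m X i) -> (1%:M <= filt D)%MS ->
  exists G : 'I_n -> 'M[F]_s,
    [/\ forall i j, G i *m G j = G j *m G i,
        (cosect G 1%:M <= 1)%N &
        forall m (A : 'M_(m, n)) (c : 'I_m -> F),
          (\rank (sect G A) <=
           \rank (\sum_(i < m) (lin_comb X (row i A) + (c i)%:M)%R)%MS)%N].
Proof.
move=> commX filtD.
have [Q [QU Qid QQ Q1]] := flag_projectors filtS filtD.
have Q0 : Q 0%N = 0 by apply/eqP; rewrite -submx0; apply: QU.
(* p d projects onto the piece of degree d, as filt d.+1 is the image of the
   polynomials of degree at most d. *)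
pose p d := Q d.+1 - Q d.
have pU d : (p d <= filt d.+1)%MS.
  by rewrite addmx_sub ?QU // eqmx_opp (submx_trans (QU d)) ?filtS.
have Zp0 m d e (Z : 'M_(m, s)) : (d <= e)%N -> (Z <= filt d)%MS -> Z *m p e = 0.
  move=> de Zd; rewrite mulmxBr !Qid ?subrr //.
    exact: submx_trans Zd (filt_le de).
  exact: submx_trans Zd (filt_le (leqW de)).
have Q_geD d e : (d <= e)%N -> Q e *m Q d = Q d.
  elim: e => [|e IHe]; first by rewrite leqn0 => /eqP ->; rewrite Q0 mulmx0.
  rewrite leq_eqVlt => /predU1P[-> |/IHe de]; first by rewrite Qid ?QU.
  by rewrite -de mulmxA QQ.
have pp0 d e : d != e -> p d *m p e = 0.
  rewrite neq_ltn => /orP[de|ed]; first exact: Zp0 de (pU d).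
  rewrite mulmxBl !mulmxBr !Q_geD ?subrr //; first exact: ltnW.
  - exact: leqW (ltnW ed).
  - exact: leqW.
have ppd d : p d *m p d = p d.
  by rewrite {1}/p mulmxBl (Zp0 _ d d (Q d)) // subr0 mulmxBr Qid // QQ.
have p_geD d : (D <= d)%N -> p d = 0.
  by move=> Dd; rewrite /p !Q1 ?subrr // leqW.
have sum_p : \sum_(d < D) p d = 1%:M.
  rewrite -(big_mkord xpredT p) telescope_sumr // Q0 subr0 Q1 //.
have pQ m d (Z : 'M_(m, s)) : Z *m Q d.+1 = Z *m p d + Z *m Q d.
  by rewrite -mulmxDr subrK.
clearbody p; pose G i := \sum_(d < D) p d *m X i *m p d.+1.
have pG d i : p d *m G i = p d *m X i *m p d.+1.
  have [dD|Dd] := ltnP d D; last by rewrite p_geD // !mul0mx.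
  rewrite mulmx_sumr (bigD1 (Ordinal dD)) //= !mulmxA ppd big1 ?addr0 // => e.
  by rewrite -val_eqE /= eq_sym => de; rewrite !mulmxA pp0 // !mul0mx.
have Gp d i : G i *m p d.+1 = p d *m X i *m p d.+1.
  have [dD|Dd] := ltnP d D; last by rewrite p_geD ?mulmx0 // leqW.
  rewrite mulmx_suml (bigD1 (Ordinal dD)) //= -mulmxA ppd big1 ?addr0 // => e.
  by rewrite -val_eqE /= => de; rewrite -mulmxA pp0 ?mulmx0.
have Gp0 i : G i *m p 0%N = 0.
  by rewrite mulmx_suml big1 // => e _; rewrite -mulmxA pp0 ?mulmx0.
clearbody G.
(* The part of [p d *m X i] of degree at most d is sent by [X j] into [filt d.+2], where [p d.+2]
   vanishes. *)
have pGG d i j : p d *m (G i *m G j) = p d *m (X i *m X j) *m p d.+2.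
  have ZU : (p d *m X i <= filt d.+2)%MS by apply: filtX.
  rewrite !mulmxA pG -mulmxA pG !mulmxA; move: (p d *m X i) ZU => Z ZU.
  have ZE : Z *m X j = Z *m p d.+1 *m X j + Z *m Q d.+1 *m X j.
    by rewrite -mulmxDl -pQ Qid.
  rewrite ZE mulmxDl [X in _ + X](Zp0 _ d.+2) ?addr0 //.
  by apply: filtX; apply: mulmx_sub.
have GS i : (G i <= sect G (1%:M : 'M_n))%MS.
  have -> : G i = lin_comb G (delta_mx 0 i).
    rewrite /lin_comb (bigD1 i) //= mxE !eqxx scale1r big1 ?addr0 // => j ji.
    by rewrite mxE (negPf ji) andbF scale0r.
  exact/lin_comb_sub/submx1.
have pS d : (p d.+1 <= sect G (1%:M : 'M_n))%MS.
  rewrite -ppd; apply: submx_trans (submxMr _ (pU _)) _.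
  have -> : filt d.+2 = (u + (filt d.+1 + \sum_i filt d.+1 *m X i))%MS by [].
  have uU : (u <= filt d.+1)%MS by apply: addsmxSl.
  rewrite addsmxMr (Zp0 _ _ _ _ (leqnn _) uU) adds0mx.
  rewrite addsmxMr (Zp0 _ _ _ _ (leqnn d.+1) (submx_refl _)) adds0mx sumsmxMr.
  apply/sumsmx_subP => i _.
  have: (filt d.+1 <= filt d.+1)%MS by [].
  move: {1 3}(filt d.+1) => Z ZU.
  have ZE : Z *m X i = Z *m p d *m X i + Z *m Q d *m X i.
    by rewrite -mulmxDl -pQ Qid.
  rewrite ZE mulmxDl [X in _ + X](Zp0 _ d.+1) ?addr0 //; last first.
    by apply: filtX; apply: mulmx_sub.
  by rewrite -!mulmxA mulmx_sub // mulmxA -pG mulmx_sub.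
exists G; split.
- move=> i j; rewrite -[LHS]mul1mx -[RHS]mul1mx -sum_p !mulmx_suml.
  by apply: eq_bigr => d _; rewrite !pGG commX.
- have rp0 : (\rank (p 0%N) <= 1)%N.
    apply: leq_trans (mxrankS (pU 0%N)) _; apply: leq_trans (rank_leq_row u).
    rewrite mxrankS //= addsmx_sub submx_refl adds0mx /=.
    by apply/sumsmx_subP=> i _; rewrite mul0mx sub0mx.
  have: ((1%:M : 'M_s) <= p 0%N + sect G (1%:M : 'M_n))%MS.
    rewrite -sum_p; apply: summx_sub => -[[|d] dD] _ /=; first exact: addsmxSl.
    exact: submx_trans (pS d) (addsmxSr _ _).
  move/mxrankS; rewrite mxrank1 => /leq_trans /(_ (mxrank_adds_leqif _ _)).
  rewrite /cosect; lia.
move=> m A c; set Y := (\sum_(i < m) _)%MS.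
(* The degree d piece of [sect G A] lies in the image of [Y :&: filt d.+1] under [p d], which kills
   [Y :&: filt d]; the sum over d telescopes. *)
have step d : (\rank (sect G A *m p d) + \rank (Y :&: filt d)%MS <=
               \rank (Y :&: filt d.+1)%MS)%N.
  rewrite -(mxrank_mul_ker (Y :&: filt d.+1)%MS (p d)); apply: leq_add; last first.
    apply: mxrankS; rewrite sub_capmx capmxS ?filtS //=.
    by rewrite sub_kermx (Zp0 _ d d) // capmxSr.
  apply: mxrankS; rewrite sumsmxMr; apply/sumsmx_subP => i _.
  case: d => [|d].
    rewrite mulmx_suml big1 ?sub0mx // => j _.
    by rewrite -scalemxAl Gp0 scaler0.
  pose Z := lin_comb X (row i A) + (c i)%:M.
  (* The scalar [c i] preserves degrees, so it disappears between [p d] and [p d.+1]. *)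
  have -> : lin_comb G (row i A) *m p d.+1 = p d *m Z *m p d.+1.
    rewrite /Z mulmxDr mulmxDl mul_mx_scalar -scalemxAl pp0 ?scaler0 ?addr0 //.
      rewrite mulmx_suml mulmx_sumr mulmx_suml; apply: eq_bigr => j _.
      by rewrite -scalemxAr -!scalemxAl Gp.
    by rewrite neq_ltn leqnn.
  apply: submxMr; rewrite sub_capmx filt_lin_comb ?pU // andbT.
  by apply: mulmx_sub; apply: (sumsmx_sup i).
have rkW : (\rank (sect G A) <= \sum_(d < D) \rank (sect G A *m p d))%N.
  rewrite -[X in (\rank X <= _)%N]mulmx1 -sum_p mulmx_sumr.
  elim: (D) => [|k IHk]; first by rewrite !big_ord0 mxrank0.
  rewrite !big_ord_recr /=; apply: leq_trans (mxrank_add _ _) _.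
  by rewrite leq_add2r.
have rkY k : (\sum_(d < k) \rank (sect G A *m p d) <= \rank (Y :&: filt k)%MS)%N.
  elim: k => [|k IHk]; first by rewrite big_ord0.
  rewrite big_ord_recr /=; apply: leq_trans (step k).
  by rewrite addnC leq_add2l.
apply: leq_trans rkW (leq_trans (rkY D) _).
exact/mxrankS/capmxSl.
Qed.

End AssociatedGraded.

(** * Coordinate rings and planes *)

Section QuotientModule.

Variables (F : fieldType) (n s : nat) (I : {mpoly F[n]} -> Prop).
Hypothesis idealI : is_ideal I.
Variable phi : {linear {mpoly F[n]} -> 'rV[F]_s}.
Hypothesis phi_surj : forall v, exists p, phi p = v.
Hypothesis phi_ker : forall p, phi p = 0 <-> I p.

Lemma quotient_section (e : 'I_s -> {mpoly F[n]}) p :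
  (forall k, phi (e k) = delta_mx 0 k) -> I (p - \sum_k phi p 0 k *: e k).
Proof.
move=> eE; apply/phi_ker; rewrite linearB linear_sum /=.
apply/eqP; rewrite subr_eq0 [X in X == _]row_sum_delta; apply/eqP/eq_bigr => k _.
by rewrite linearZ /= eE.
Qed.

Lemma quotient_factor d (psi : {linear {mpoly F[n]} -> 'rV[F]_d}) :
    (forall p, I p -> psi p = 0) ->
  exists T : 'M_(s, d), forall p, psi p = phi p *m T.
Proof.
move=> Ipsi.
have [e eE] := fin_all_exists (fun k : 'I_s => phi_surj (delta_mx 0 k)).
exists (\matrix_k psi (e k)) => p; rewrite mulmx_sum_row.
have /Ipsi/eqP := quotient_section p eE.
rewrite linearB subr_eq0 linear_sum => /eqP ->; apply: eq_bigr => k _.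
by rewrite linearZ rowK.
Qed.

Lemma quotient_matrices : exists X : 'I_n -> 'M[F]_s,
  forall i p, phi ('X_i * p) = phi p *m X i.
Proof.
have [e eE] := fin_all_exists (fun k : 'I_s => phi_surj (delta_mx 0 k)).
exists (fun i => \matrix_k phi ('X_i * e k)) => i p; rewrite mulmx_sum_row.
have [_ _ mulI] := idealI; have := mulI 'X_i _ (quotient_section p eE).
move/phi_ker/eqP; rewrite mulrBr mulr_sumr linearB subr_eq0 linear_sum => /eqP ->.
by apply: eq_bigr => k _; rewrite -scalerAr linearZ rowK.
Qed.

Variable X : 'I_n -> 'M[F]_s.
Hypothesis phiX : forall i p, phi ('X_i * p) = phi p *m X i.

Lemma quotient_matricesC i j : X i *m X j = X j *m X i.
Proof.
apply/row_matrixP => k; rewrite -[X i *m X j]mul1mx -[X j *m X i]mul1mx !row_mul.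
have [p <-] := phi_surj (row k 1%:M).
by rewrite !mulmxA -!phiX mulrCA.
Qed.

Lemma quotient_filt p : (phi p <= filt X (phi 1) (msize p))%MS.
Proof.
have mono m : (phi 'X_[m] <= filt X (phi 1) (mdeg m).+1)%MS.
  move: {2}(mdeg m) (erefl (mdeg m)) => d; elim: d m => [|d IHd] m md.
    have /eqP -> : m == 0%MM by rewrite -mdeg_eq0 md.
    by rewrite mpolyX0; apply: addsmxSl.
  have [i mi] : exists i, (U_(i) <= m)%MM.
    suff /existsP[i mi] : [exists i, m i != 0%N] by exists i; rewrite lep1mP.
    rewrite -negb_forall; apply/negP=> /forallP m0.
    suff m_0 : m = 0%MM by rewrite m_0 mdeg0 in md.
    by apply/mnmP=> i; rewrite mnm0E; apply/eqP.
  have md' : mdeg (m - U_(i))%MM = d.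
    by apply: succn_inj; rewrite -md -[in RHS](submK mi) mdegD mdeg1 addn1.
  rewrite -{1}(submK mi) addmC mpolyXD phiX md -md'; apply: filtX; exact: IHd.
rewrite [p in phi p]mpolyE linear_sum big_seq; apply: summx_sub => m mp.
rewrite linearZ scalemx_sub // (submx_trans (mono m)) // filt_le //.
exact: msize_mdeg_lt.
Qed.

Lemma quotient_filt_full : exists D, (1%:M <= filt X (phi 1) D)%MS.
Proof.
have [e eE] := fin_all_exists (fun k : 'I_s => phi_surj (delta_mx 0 k)).
exists (\max_k msize (e k)); apply/row_subP => k; rewrite rowE mulmx1 -eE.
by apply: submx_trans (quotient_filt _) (filt_le _ _ _); rewrite leq_bigmax.
Qed.

Lemma quotient_affine (a : 'rV[F]_n) (c : F) p :
  phi ((\sum_j a 0 j *: 'X_j + c%:MP) * p) = phi p *m (lin_comb X a + c%:M).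
Proof.
rewrite mulrDl mulr_suml mul_mpolyC linearD linearZ linear_sum /= mulmxDr.
rewrite mul_mx_scalar mulmx_sumr; congr (_ + _); apply: eq_bigr => j _.
by rewrite -scalerAl linearZ phiX -scalemxAr.
Qed.

(** The quotient map of the larger ideal is [phi] followed by a matrix [T] of rank d, whose kernel
    has dimension s - d and contains every l_i M. *)
Lemma quotient_adjoin_rank m d (l : 'I_m -> {mpoly F[n]}) (A : 'M[F]_(m, n))
    (c : 'I_m -> F) :
    (forall i, l i = \sum_j A i j *: 'X_j + (c i)%:MP) ->
    has_quot_dim (ideal_adjoin I l) d ->
  (d + \rank (\sum_i (lin_comb X (row i A) + (c i)%:M)%R)%MS <= s)%N.
Proof.
move=> lE [psi [psi_surj psi_ker]].
have [T psiE] : exists T : 'M_(s, d), forall p, psi p = phi p *m T.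
  apply: quotient_factor => p Ip; apply/psi_ker; exists p => //.
  by exists (fun=> 0); rewrite big1 ?addr0 // => i _; rewrite mul0r.
have rT : \rank T = d.
  apply/eqP; rewrite -[_ == _]/(row_full T) -sub1mx; apply/row_subP => k.
  by have [p <-] := psi_surj (row k 1%:M); rewrite psiE submxMl.
have: (\sum_i (lin_comb X (row i A) + (c i)%:M)%R <= kermx T)%MS.
  apply/sumsmx_subP => i _; apply/sub_kermxP/row_matrixP => k.
  rewrite -[_ *m T]mul1mx row_mul row0; have [p <-] := phi_surj (row k 1%:M).
  rewrite mulmxA -quotient_affine -psiE; apply/psi_ker.
  have [I0 _ _] := idealI; exists 0 => //.
  exists (fun i' => if i' == i then p else 0); rewrite add0r.
  have -> : \sum_i' (if i' == i then p else 0) * l i' = p * l i.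
    by rewrite (bigD1 i) //= eqxx big1 ?addr0 // => i' /negPf ->; rewrite mul0r.
  by rewrite lE mulrC; under [in LHS]eq_bigr do rewrite mxE.
move/mxrankS; rewrite mxrank_ker rT; have := rank_leq_row T; rewrite rT; lia.
Qed.

End QuotientModule.

Lemma msize_le2E (F : fieldType) (n : nat) (p : {mpoly F[n]}) :
  (msize p <= 2)%N -> p = \sum_j linear_part p 0 j *: 'X_j + (p@_0)%:MP.
Proof.
move=> sp; apply/mpolyP => m; rewrite mcoeffD mcoeffC raddf_sum /=.
under eq_bigr do rewrite mcoeffZ mcoeffX mxE.
have [->|m0] := eqVneq m 0%MM.
  by rewrite big1 ?add0r ?mulr1 // => j _; rewrite mnm1_eq0 mulr0.
rewrite mulr0 addr0; have [/existsP[i /eqP->]|mU] := boolP [exists i, m == U_(i)%MM].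
  rewrite (bigD1 i) //= eqxx mulr1 big1 ?addr0 // => j /negPf ji.
  by rewrite eq_mnm1 ji mulr0.
rewrite big1 => [|j _]; last first.
  move: mU; rewrite negb_exists => /forallP /(_ j); rewrite eq_sym => /negPf ->.
  by rewrite mulr0.
apply: memN_msupp_eq0; apply: msize_mdeg_ge; apply: leq_trans sp _.
by move: mU m0; rewrite -mdeg_eq1 -mdeg_eq0; case: (mdeg m) => [|[]].
Qed.

Lemma row_kernel_sub (F : fieldType) (m1 m2 n : nat) (A : 'M[F]_(m1, n))
    (B : 'M[F]_(m2, n)) :
    (forall y : 'rV_n, y *m A^T = 0 -> y *m B^T = 0) -> (B <= A)%MS.
Proof.
move=> AB; rewrite submxE -trmx_eq0 trmx_mul; apply/eqP/row_matrixP => k.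
rewrite row_mul row0; apply: AB; rewrite -row_mul -trmx_mul mulmx_coker.
by rewrite trmx0 row0.
Qed.

(** The rows are normals: the direction space of [V] is the space they annihilate, not their
    span. *)
Definition direction_mx (F : fieldType) (n k : nat) (V : kplane F n k) :
  'M[F]_(n - k, n) := \matrix_i linear_part (V i).

Lemma kplane_affine (F : fieldType) (n k : nat) (V : kplane F n k) i :
  V i = \sum_j direction_mx V i j *: 'X_j + ((V i)@_0)%:MP.
Proof.
rewrite {1}[V i]msize_le2E ?kplane_deg //.
by congr (_ + _); apply: eq_bigr => j _; rewrite [in RHS]mxE.
Qed.

Lemma on_kplaneP (F : fieldType) (n k : nat) (V : kplane F n k) (x : 'rV_n) :
  on_kplane V x <-> x *m (direction_mx V)^T + \row_i (V i)@_0 = 0.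
Proof.
have evalV i : (V i).@[x 0] = (x *m (direction_mx V)^T + \row_i (V i)@_0) 0 i.
  rewrite [in LHS]kplane_affine mevalD mevalC raddf_sum /=.
  rewrite [RHS]mxE [X in _ = X + _]mxE [X in _ = _ + X]mxE; congr (_ + _).
  by apply: eq_bigr => j _; rewrite mevalZ mevalXU [in RHS]mxE mulrC.
split=> [Vx|Vx i]; last by rewrite evalV Vx mxE.
by apply/rowP => i; rewrite -evalV Vx mxE.
Qed.

(** The base point of a translate lies on the plane, so [L] is the solution space of the homogeneous
    equations of both planes; duality passes from solutions to equations. *)
Lemma parallel_direction (F : fieldType) (n k : nat) (V W : kplane F n k) :
  parallel V W -> (direction_mx W <= direction_mx V)%MS.
Proof.
case=> L [_ [v Vv] [w Ww]]; apply: row_kernel_sub => y.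
have kerL (U : kplane F n k) z : (forall x, on_kplane U x <-> x - z \in L) ->
    y *m (direction_mx U)^T = 0 <-> y \in L.
  move=> Uz; have /Uz/on_kplaneP Uz0 : z - z \in L by rewrite subrr mem0v.
  have := Uz (y + z); rewrite addrK on_kplaneP mulmxDl -addrA Uz0 addr0.
  by [].
by move/(kerL V v Vv)/(kerL W w Ww).
Qed.

Lemma exists_kplane (F : fieldType) (n k : nat) (L : 'M[F]_(n - k, n)) :
  row_free L -> exists W : kplane F n k, direction_mx W = L.
Proof.
move=> freeL; pose l i : {mpoly F[n]} := \sum_j L i j *: 'X_j.
have lU i j : (l i)@_U_(j) = L i j.
  rewrite raddf_sum (bigD1 j) //= mcoeffZ mcoeffXU eqxx mulr1.
  rewrite big1 ?addr0 // => j' jj.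
  by rewrite mcoeffZ mcoeffXU (negPf jj) mulr0.
have linL : \matrix_i linear_part (l i) = L.
  by apply/matrixP=> i j; rewrite !mxE lU.
have degl i : msize (l i) = 2%N.
  apply/eqP; rewrite eqn_leq; apply/andP; split.
    apply: leq_trans (msize_sum _ _ _) _; apply/bigmax_leqP => j _.
    by apply: leq_trans (msizeZ_le _ _) _; rewrite msizeX mdeg1.
  have [j Lij] : exists j, L i j != 0.
    apply/existsP; rewrite -negb_forall; apply/negP => /forallP Li0.
    have : row i L = 0 by apply/rowP => j; rewrite !mxE; apply/eqP.
    move/row_free_inj: (freeL); rewrite rowE -(mul0mx _ L) => inj /inj.
    by move/matrixP/(_ 0 i)/eqP; rewrite !mxE !eqxx oner_eq0.
  have : U_(j)%MM \in msupp (l i) by rewrite mcoeff_msupp lU.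
  by move/msize_mdeg_lt; rewrite mdeg1.
by exists (@KPlane F n k l degl (etrans (congr1 _ linL) freeL)).
Qed.

Lemma exists_kplane_direction (F : fieldType) (n k : nat) (A : 'M[F]_n) :
    (\rank A + k = n)%N ->
  exists W : kplane F n k, (direction_mx W :=: A)%MS.
Proof.
move=> rA; have e : \rank A = (n - k)%N by lia.
have [|W WE] := @exists_kplane F n k (castmx (e, erefl n) (row_base A)).
  by rewrite row_free_castmx row_base_free.
exists W; rewrite WE; apply: eqmx_trans (eqmx_cast _ _) _; exact: eq_row_base.
Qed.

(** * Climbing from dimension k to dimension n *)

Section Growth.

Variable R : realType.

Lemma cosect_pow (k d : nat) : (0 < k)%N ->
  exists2 c : R, 0 < c <= 1 &
  forall (F : finFieldType) (n s : nat) (G : 'I_n -> 'M[F]_s) (r : R),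
    (forall i j, G i *m G j = G j *m G i) -> (cosect G 1%:M <= 1)%N ->
    0 < r <= #|F|%:R ->
    (forall A : 'M_n, (\rank A + k = n)%N -> r ^+ k <= (cosect G A)%:R) ->
  forall A : 'M_n, (\rank A + (k + d) = n)%N ->
    c * r ^+ (k + d) <= (cosect G A)%:R.
Proof.
move=> k0; elim: d => [|d [c /andP[c0 c1] IHd]].
  exists 1 => [|F n s G r _ _ _ Gk A]; first by rewrite ltr01 lexx.
  by rewrite addn0 mul1r => /Gk.
have [C C0 growth] := cosect_growth (k + d)%N.
have C1 : 1 <= C%:R :> R by rewrite ler1n.
have Cgt0 : 0 < C%:R :> R by rewrite ltr0n.
set j := (k + d)%N in IHd growth *.
have j0 : (0 < j)%N by rewrite addn_gt0 k0.
(* This constant is at most 1, hence at least its own j-th power, which spares a j-th root in the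
   first alternative; it is also at most c / C, which serves the second together with
   [r <= #|F|]. *)
exists (c ^+ j.+1 / C%:R) => [|F n s G r cG G1 /andP[r0 rq] Gk A].
  rewrite divr_gt0 ?exprn_gt0 //= ler_pdivrMr // mul1r (le_trans _ C1) //.
  by rewrite exprn_ile1 // ltW.
rewrite addnS -/j => rA; have [B [AB rB growthB]] := growth F n s G cG G1 A rA.
have EB := IHd F n s G r cG G1 (introT andP (conj r0 rq)) Gk B.
have {}EB : c * r ^+ j <= (cosect G B)%:R by apply: EB; lia.
have cr0 : 0 <= c * r ^+ j by rewrite mulr_ge0 ?exprn_ge0 // ltW.
case: growthB => growthB.
  have : (c * r ^+ j) ^+ j.+1 <= C%:R * (cosect G A)%:R ^+ j.
    apply: le_trans (_ : (cosect G B)%:R ^+ j.+1 <= _).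
    by rewrite lerXn2r ?nnegrE.
    by rewrite -!natrX -natrM ler_nat.
  rewrite exprMn -exprM -ler_pdivrMl // mulrA [_^-1 * _]mulrC => h.
  rewrite -(@ler_pXn2r _ j) ?nnegrE //; last first.
    by rewrite mulr_ge0 ?exprn_ge0 ?divr_ge0 ?exprn_ge0 // ltW.
  apply: le_trans h; rewrite exprMn -exprM mulnC.
  apply: ler_wpM2r; first by rewrite exprn_ge0 // ltW.
  apply: ler_iXnr => //; first by rewrite divr_ge0 ?exprn_ge0 // ltW.
  by rewrite ler_pdivrMr // mul1r (le_trans _ C1) // exprn_ile1 // ltW.
have : #|F|%:R * (c * r ^+ j) <= C%:R * (cosect G A)%:R.
  apply: le_trans (_ : #|F|%:R * (cosect G B)%:R <= _).
    by rewrite ler_wpM2l.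
  by rewrite -!natrM ler_nat.
rewrite -ler_pdivrMl //; apply: le_trans.
have -> : c ^+ j.+1 / C%:R * r ^+ j.+1 =
    C%:R^-1 * (r * (c ^+ j * (c * r ^+ j))).
  by rewrite !exprS; ring.
apply: ler_wpM2l; first by rewrite invr_ge0 ltW.
apply: ler_pM => //.
- exact: ltW.
- by rewrite mulr_ge0 // exprn_ge0 // ltW.
- by rewrite ler_piMl // exprn_ile1 // ltW.
Qed.

End Growth.

Theorem theorem1p5 (R : realType) (n k : nat) (hk : (1 <= k <= n)%N) :
  exists2 C : R, 0 < C &
  forall (F : finFieldType) (I_S : {mpoly F[n]} -> Prop) (size_S : nat) (c : R),
    is_ideal I_S ->
    has_quot_dim I_S size_S ->
    0 <= c <= k%:R ->
    (forall W : kplane F n k,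
      exists2 V : kplane F n k, parallel V W &
      exists2 size_SV : nat, has_quot_dim (ideal_adjoin I_S V) size_SV &
        (#|F|%:R : R) `^ c <= size_SV%:R) ->
    C * (#|F|%:R : R) `^ (c * n%:R / k%:R) < size_S%:R.
Proof.
have /andP[k0 kn] := hk.
have [C /andP[C0 _] main] := @cosect_pow R k (n - k) k0.
(* Halving the constant makes the final inequality strict. *)
exists (C / 2) => [|F I s c idealI [phi [phi_surj phi_ker]] /andP[c0 ck] rich].
  by rewrite divr_gt0.
have [X phiX] := quotient_matrices idealI phi_surj phi_ker.
have [D fullD] := quotient_filt_full phi_surj phiX.
have [G [commG G1 rkG]] := associated_graded (quotient_matricesC phi_surj phiX) fullD.
set q : R := #|F|%:R.
have q1 : 1 <= q by rewrite ler1n; apply/card_gt0P; exists 0.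
have q0 : 0 < q by apply: lt_le_trans q1.
(* With r = q^(c/k) <= q, only natural powers of r occur. *)
pose r := q `^ (c / k%:R).
have k0R : 0 < k%:R :> R by rewrite ltr0n.
have r0 : 0 < r by apply: powR_gt0.
have rq : r <= q by apply: ler1_powR => //; rewrite ler_pdivrMr // mul1r.
have rX m : r ^+ m = q `^ (c * m%:R / k%:R).
  by rewrite -powR_mulrn ?ltW // -powRrM mulrAC.
have := main F n s G r commG G1; rewrite r0 rq => /(_ isT) {}main.
(* A plane [W] with linear parts spanning [A] is replaced by the rich parallel plane [V]; [rkG]
   absorbs the constant terms of [V]. *)
have sections (A : 'M_n) : (\rank A + k = n)%N -> r ^+ k <= (cosect G A)%:R.
  move=> rA; have [W WA] := exists_kplane_direction rA.
  have [V VW [d dV qd]] := rich W.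
  rewrite rX mulfK ?gt_eqF //; apply: le_trans qd _; rewrite ler_nat.
  have rkV := quotient_adjoin_rank idealI phi_surj phi_ker phiX (kplane_affine V) dV.
  have rkGV := rkG _ (direction_mx V) (fun i => (V i)@_0).
  have AV : (A <= direction_mx V)%MS by rewrite -WA parallel_direction.
  have rkA := leq_trans (mxrankS (sectS G AV)) rkGV.
  have : (d + \rank (sect G A) <= s)%N.
    by apply: leq_trans rkV; rewrite leq_add2l.
  by rewrite /cosect; lia.
(* The zero matrix imposes no equation: its section is the whole module, of dimension at most
   [s]. *)
have := main sections 0; rewrite mxrank0 subnKC // => /(_ erefl).
rewrite rX => bound; apply: lt_le_trans (le_trans bound _); last first.
  by rewrite ler_nat leq_subr.
by rewrite ltr_pM2r ?powR_gt0 // ltr_pdivrMr // ltr_pMr // ltr1n.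
Qed.
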